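(* Let $G,H$ be topological Abelian groups, and suppose that $\mathcal{N}_{GP}^{\sigma}(G)$ is a proper $\sigma$-ideal in $G$ (that is, $G\notin\mathcal{N}_{GP}^{\sigma}(G)$), and $\mathcal{N}_{GP}^{\sigma}(H)$ is a proper $\sigma$-ideal in $H$ (that is, $H\notin\mathcal{N}_{GP}^{\sigma}(H)$). Then the following statements are true. (i) If $f\colon G\times H\to\mathbb{C}$ is a separately generalized polynomial function, then $f$ is a generalized polynomial on $G\times H$ with respect to the discrete topology. (ii) Every jointly continuous separately generalized polynomial function $f\colon G\times H\to\mathbb{C}$ is a generalized polynomial on $G\times H$. (iii) If $G$ and $H$ are connected and a separately generalized polynomial function $f\colon G\times H\to\mathbb{C}$ has at least one point of joint continuity, then $f$ is a generalized polynomial on $G\times H$.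
   Context: Groups are written additively. For a topological Abelian group $G$, a function $f\colon G\to\mathbb{C}$ and $h\in G$, put $\Delta_h f(x)=f(x+h)-f(x)$. A continuous function $f\colon G\to\mathbb{C}$ is a generalized polynomial if there is an integer $n\ge 0$ such that $\Delta_{h_1}\cdots\Delta_{h_{n+1}}f=0$ for every $h_1,\ldots,h_{n+1}\in G$. The set of generalized polynomials on $G$ is denoted by $\mathcal{GP}_G$. ''Generalized polynomial with respect to the discrete topology'' means a generalized polynomial on the group equipped with the discrete topology, so that continuity is no restriction. Unless stated otherwise, $G\times H$ carries the product topology and the coordinatewise group operation. For $f\colon G\times H\to\mathbb{C}$, the sections are $f_x\colon H\to\mathbb{C}$ and $f^y\colon G\to\mathbb{C}$, $f_x(y)=f^y(x)=f(x,y)$. The function $f$ is a separately generalized polynomial function if $f_x\in\mathcal{GP}_H$ for every $x\in G$ and $f^y\in\mathcal{GP}_G$ for every $y\in H$ (with respect to the given topologies of $H$ and $G$). Joint continuity means continuity with respect to the product topology on $G\times H$; a point of joint continuity is a point of $G\times H$ at which $f$ is continuous in this sense. For $p\colon G\to\mathbb{C}$ let $Z_p=\{x\in G: p(x)=0\}$. Let $\mathcal{N}_{GP}(G)=\{A\subset G: \text{there is } p\in\mathcal{GP}_G,\ p\ne 0 \text{ (not identically zero)},\ A\subset Z_p\}$, and let $\mathcal{N}_{GP}^{\sigma}(G)$ be the $\sigma$-ideal of subsets of $G$ generated by $\mathcal{N}_{GP}(G)$; likewise for $H$. *)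

(* Defs.v *)
From HB Require Import structures.
From mathcomp Require Import all_boot all_order all_algebra.
From mathcomp Require Import complex.
From mathcomp Require Import boolp classical_sets reals.
From mathcomp Require Import topology pseudometric_normed_Zmodule tvs.

Set Implicit Arguments.
Unset Strict Implicit.
Unset Printing Implicit Defensive.

Import GRing.Theory.
Local Open Scope classical_set_scope.
Local Open Scope ring_scope.

(* R[i] has no canonical topology; the regular alias carries the one induced
   by the modulus. *)
Notation Cplx R := ((complex R)^o).

(* The library makes a product a topologicalZmodType only when both factors
   are tvsType's, and that instance shadows any more general one, so the
   structure on G * H is packed explicitly. Topology and addition are the
   canonical ones of the product type. *)
Section prod_topologicalZmod.
Variables G H : topologicalZmodType.

Lemma prod_add_continuous :
  continuous (fun x : (G * H) * (G * H) => x.1 + x.2).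
Proof.
move=> [/= xy1 xy2] /= U /= [] [A B] /= [nA nB] nU.
have [/= A0 [A01 A02] nA1] := @tvs.add_continuous G (xy1.1, xy2.1) _ nA.
have [/= B0 [B01 B02] nB1] := @tvs.add_continuous H (xy1.2, xy2.2) _ nB.
exists ([set xy | A0.1 xy.1 /\ B0.1 xy.2], [set xy | A0.2 xy.1 /\ B0.2 xy.2]).
  by split; [exists (A0.1, B0.1)|exists (A0.2, B0.2)].
move => [[x1 y1] [x2 y2]] /= [] [] a1 b1 [] a2 b2.
by apply: nU; split; [exact: (nA1 (x1, x2))|exact: (nB1 (y1, y2))].
Qed.

Lemma prod_opp_continuous : continuous (fun x : G * H => - x).
Proof.
move=> [x y] /= U /= [] [A B] /= [nA nB] nU.
exists ((fun z : G => - z) @^-1` A, (fun z : H => - z) @^-1` B).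
  by split; [exact: (@tvs.opp_continuous G x)|exact: (@tvs.opp_continuous H y)].
by move=> [a b] /= [Aa Bb]; exact: nU.
Qed.

Let prod_addM := PreTopologicalNmodule_isTopologicalNmodule.Build
  (G * H)%type prod_add_continuous.
Let prod_oppM := TopologicalNmodule_isTopologicalZmodule.Build
  (G * H)%type prod_opp_continuous.

Definition prod_topZmod : topologicalZmodType :=
  HB.pack (G * H)%type prod_addM prod_oppM.

End prod_topologicalZmod.

Section discrete_topologicalZmod.
Variable T : zmodType.

HB.instance Definition _ := GRing.Zmodule.copy (discrete_topology T) T.

Lemma discrete_add_continuous :
  continuous (fun x : discrete_topology T * discrete_topology T => x.1 + x.2).
Proof.
move=> [x y] U /= /nbhs_singleton Uxy.
exists ([set x], [set y]) => /=; first by split; exact: discrete_set1.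
by move=> [a b] /= [-> ->].
Qed.

Lemma discrete_opp_continuous :
  continuous (fun x : discrete_topology T => - x).
Proof.
move=> x U /= /nbhs_singleton Ux.
apply: (@filterS _ (nbhs x) _ [set x]); first by move=> _ ->.
exact: discrete_set1.
Qed.

HB.instance Definition _ := PreTopologicalNmodule_isTopologicalNmodule.Build
  (discrete_topology T) discrete_add_continuous.
HB.instance Definition _ := TopologicalNmodule_isTopologicalZmodule.Build
  (discrete_topology T) discrete_opp_continuous.

End discrete_topologicalZmod.

Definition fdiff (G V : zmodType) (h : G) (f : G -> V) : G -> V :=
  fun x => f (x + h) - f x.

Definition GP (R : realType) (G : topologicalZmodType) : set (G -> Cplx R) :=
  [set f | continuous f /\
    exists n : nat, forall hs : n.+1.-tuple G,
      foldr (@fdiff G (Cplx R)) f hs = (fun=> 0)].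
Arguments GP : clear implicits.

Definition separately_GP (R : realType) (G H : topologicalZmodType)
    (f : G * H -> Cplx R) : Prop :=
  (forall x : G, GP R H (fun y => f (x, y))) /\
  (forall y : H, GP R G (fun x => f (x, y))).

Definition zero_set (R : realType) (T : Type) (p : T -> Cplx R) : set T :=
  [set x | p x = 0].

Definition N_GP (R : realType) (G : topologicalZmodType) : set (set G) :=
  [set A | exists p : G -> Cplx R,
    [/\ GP R G p, p <> (fun=> 0) & A `<=` zero_set p]].
Arguments N_GP : clear implicits.

Definition sigma_ideal (T : Type) (I : set (set T)) : Prop :=
  [/\ I set0,
      forall A B : set T, A `<=` B -> I B -> I A &
      forall A : nat -> set T, (forall k, I (A k)) -> I (\bigcup_k A k)].

Definition sigma_N_GP (R : realType) (G : topologicalZmodType) : set (set G) :=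
  smallest (@sigma_ideal G) (N_GP R G).
Arguments sigma_N_GP : clear implicits.

(* Main.v *)
Require Import Defs.
From HB Require Import structures.
From mathcomp Require Import all_boot all_order all_algebra.
From mathcomp Require Import complex.
From mathcomp Require Import boolp classical_sets reals.
From mathcomp Require Import topology pseudometric_normed_Zmodule tvs.
From mathcomp Require Import ring zify.

Set Implicit Arguments.
Unset Strict Implicit.
Unset Printing Implicit Defensive.

(** Two facts carry the theorem.

    Separate polynomials are joint polynomials.  The group G is the union of
    the sets A_n of those x whose section f_x has degree less than n.  As G is
    not in the sigma-ideal, some A_n is not in it either, so the only
    generalized polynomial vanishing on A_n is 0.  For fixed steps h_1, ...,
    h_n and a fixed y, the n-th difference of f_x at y is, as a function of x,
    a combination of the sections f^y', hence a generalized polynomial; it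
    vanishes on A_n, so it vanishes on G.  Thus the degrees of all sections f_x
    are bounded ([degree_lt_uniform]), and symmetrically for f^y.  Since
    a joint difference with step (h, k) is the sum of a difference in x and
    a difference in y, bounded separate degrees m and n give joint degree at
    most m + n ([separately_degree_lt]).  This proves (i), and (ii) only adds
    the continuity that is assumed there.

    A polynomial p on a connected group that is continuous at one point is
    continuous.  Continuity at z bounds p on z + W + ... + W for a neighbourhood
    W of 0 and any prescribed number of summands.  If the degree
    of p is less than n, a bound for all numbers of summands below n propagates,
    with a larger constant, to every number of summands ([norm_growth]).  By
    connectedness W generates G ([connected_sums]), so p is locally bounded.
    Finally, a polynomial that is bounded by M along a long progression x,
    x + w, ..., x + N w has a first increment of at most e, where N depends only
    on M, e and the degree ([increment_small]); local boundedness therefore yields continuity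
    ([degree_lt_continuous]).  Applied to G * H, this proves (iii). *)

Import Order.TTheory GRing.Theory Num.Theory.
Local Open Scope classical_set_scope.
Local Open Scope ring_scope.

(** * Polynomials as functions killed by iterated differences *)

Section degree.
Variables G V : zmodType.
Implicit Types f g : G -> V.

(** Peeling off the innermost difference turns every proof about the degree
    into an induction in which the difference of f replaces f. *)
Fixpoint degree_lt n f : Prop :=
  if n is m.+1 then forall h, degree_lt m (fdiff h f) else f = (fun=> 0).

Lemma degree_lt_foldr n f :
  degree_lt n f <-> forall hs : n.-tuple G, foldr (@fdiff G V) f hs = (fun=> 0).
Proof.
suff E : degree_lt n f <->
    forall hs : seq G, size hs = n -> foldr (@fdiff G V) f hs = (fun=> 0).
  rewrite E; split=> [f0 hs|f0 hs hsn]; first by apply: f0; rewrite size_tuple.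
  by have := f0 (tcast hsn (in_tuple hs)); rewrite val_tcast.
elim: n f => [|n IHn] f /=.
  by split=> [-> [|]//|/(_ [::] erefl)].
split=> [fn hs|fn h].
  (* foldr applies the last step of the list first *)
  case/lastP: hs => // hs h; rewrite size_rcons => -[hsn].
  by rewrite foldr_rcons; apply: (IHn _).1 hsn.
apply/IHn => hs hsn; rewrite -foldr_rcons.
by apply: fn; rewrite size_rcons hsn.
Qed.

Lemma fdiff0 h : fdiff h (fun=> 0 : V) = (fun=> 0) :> (G -> V).
Proof. by apply/funext => x; rewrite /fdiff subrr. Qed.

Lemma degree_lt0 n : degree_lt n (fun=> 0).
Proof. by elim: n => //= n IHn h; rewrite fdiff0. Qed.

Lemma degree_ltS n f : degree_lt n f -> degree_lt n.+1 f.
Proof.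
elim: n f => [|n IHn] f /=; first by move=> -> h; rewrite fdiff0.
by move=> fn h; apply: IHn.
Qed.

Lemma degree_lt_leq m n f : (m <= n)%N -> degree_lt m f -> degree_lt n f.
Proof.
by move=> /subnK <- fm; elim: (n - m)%N => //= k; exact: degree_ltS.
Qed.

Lemma degree_ltB n f g :
  degree_lt n f -> degree_lt n g -> degree_lt n (fun x => f x - g x).
Proof.
elim: n f g => [|n IHn] f g /=.
  by move=> -> ->; apply/funext => x; rewrite subrr.
move=> fn gn h; have -> : fdiff h (fun x => f x - g x) =
    (fun x => fdiff h f x - fdiff h g x).
  apply/funext => x; rewrite /fdiff !opprB addrACA [RHS]addrACA.
  by congr (_ + _); exact: addrC.
exact: IHn.
Qed.

Lemma degree_ltD n f g :
  degree_lt n f -> degree_lt n g -> degree_lt n (fun x => f x + g x).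
Proof.
move=> fn gn; have -> : (fun x => f x + g x) = (fun x => f x - (0 - g x)).
  by apply/funext => x; rewrite sub0r opprK.
by apply: degree_ltB fn _; apply: degree_ltB gn; exact: degree_lt0.
Qed.

Lemma degree_lt_shift n f k :
  degree_lt n f -> degree_lt n (fun x => f (x + k)).
Proof.
elim: n f => [|n IHn] f /=; first by move=> ->.
move=> fn h; have -> : fdiff h (fun x => f (x + k)) =
    (fun x => fdiff h f (x + k)).
  by apply/funext => x; rewrite /fdiff addrAC.
exact: IHn.
Qed.

End degree.

(** Induction on m + n: the difference with step (h, k) splits into
    a difference in x of step h, which lowers m, and a difference in y of
    step k, which lowers n. *)
Lemma separately_degree_lt (G H V : zmodType) m n (f : G * H -> V) :
    (forall y, degree_lt m (fun x => f (x, y))) ->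
    (forall x, degree_lt n (fun y => f (x, y))) ->
  degree_lt (m + n) f.
Proof.
move: {2}(m + n)%N (erefl (m + n)%N) => d.
elim: d m n f => [|d IHd] [|m] [|n] f // => [_|mnd|mnd|mnd] fm fn.
- by apply/funext => -[x y]; have /(congr1 (@^~ x)) := fm y.
- have -> : f = (fun=> 0); last exact: degree_lt0.
  by apply/funext => -[x y]; have /(congr1 (@^~ x)) := fm y.
- have -> : f = (fun=> 0); last exact: degree_lt0.
  by apply/funext => -[x y]; have /(congr1 (@^~ y)) := fn x.
rewrite mnd => -[h k].
pose f1 z := f (z.1 + h, z.2 + k) - f (z.1, z.2 + k).
pose f2 z := f (z.1, z.2 + k) - f z.
have -> : fdiff (h, k) f = (fun z => f1 z + f2 z).
  by apply/funext => -[x y]; rewrite /fdiff/f1/f2/= addrA subrK.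
apply: degree_ltD.
  have -> : d = (m + n.+1)%N by lia.
  apply: IHd => [|y|x]; first by lia.
    exact: fm (y + k) h.
  exact: degree_ltB (degree_lt_shift k (fn (x + h))) (degree_lt_shift k (fn x)).
have -> : d = (m.+1 + n)%N by lia.
apply: IHd => [|y|x]; first by lia.
  exact: degree_ltB (fm (y + k)) (fm y).
exact: fn x k.
Qed.

(** * Quantitative estimates for polynomials *)

Section quantitative.
Variables (G : zmodType) (K : numFieldType) (V : normedZmodType K).
Implicit Types p : G -> V.

(** The value at a sum u + s is the value at s plus the increment with step u.
    The increment is a polynomial of lower degree, bounded by 2M on the sums
    that have one summand fewer, so adding a summand multiplies the bound by
    1 + 2 = 3. *)
Lemma norm_growth (U : set G) (s : seq G) n p (M : K) x0 :
    0 <= M -> degree_lt n p ->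
    (forall t : seq G, (size t < n)%N -> [set` t] `<=` U ->
      `|p (x0 + \sum_(u <- t) u)| <= M) ->
    [set` s] `<=` U ->
  `|p (x0 + \sum_(u <- s) u)| <= M * 3 ^+ size s.
Proof.
elim: s n p M => [|u s IHs] [|n] p M M0.
- by move=> -> _ _; rewrite normr0 mulr1.
- by move=> _ pM U0; rewrite mulr1; exact: pM.
- by move=> -> _ _; rewrite normr0 mulr_ge0// exprn_ge0.
move=> pn pM usU.
have Uu : U u by apply: usU; rewrite /= mem_head.
have sU : [set` s] `<=` U.
  by move=> v vs; apply: usU; rewrite /= inE (vs : v \in s) orbT.
rewrite big_cons.
have -> : p (x0 + (u + \sum_(v <- s) v)) =
    fdiff u p (x0 + \sum_(v <- s) v) + p (x0 + \sum_(v <- s) v).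
  by rewrite /fdiff subrK addrAC -addrA.
apply: (le_trans (ler_normD _ _)).
have -> : M * 3 ^+ size (u :: s) = (M + M) * 3 ^+ size s + M * 3 ^+ size s.
  by rewrite /= exprS; ring.
apply: lerD; last exact: IHs pn pM sU.
apply: (IHs n); [by rewrite addr_ge0|exact: pn| |exact: sU].
move=> t tn tU; rewrite /fdiff; apply: (le_trans (ler_normB _ _)); apply: lerD.
  have := pM (u :: t); rewrite big_cons/= addrA addrAC; apply=> //.
  by move=> v; rewrite /= inE => /orP[/eqP->//|]; exact: tU.
by apply: pM tU; exact: ltnW.
Qed.

(** Norms take values in K itself, and K is only partially ordered when it is
    the field of complex numbers. *)
Hypothesis archK : Num.archimedean_axiom K.

(** Induction on the degree.  Let D be the increment of p with step x.  The
    induction hypothesis, applied to D along the progression, shows that D is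
    almost constant over L steps, so p (x0 + L x) - p x0 is close to L D (x0).
    The former is at most 2M, hence D (x0) is small when L is large. *)
Lemma increment_small n (M e : K) : 0 <= M -> 0 < e ->
  exists N : nat, forall p x0 x, degree_lt n p ->
    (forall j, (j <= N)%N -> `|p (x0 + x *+ j)| <= M) ->
    `|p (x0 + x) - p x0| <= e.
Proof.
elim: n M e => [|n IHn] M e M0 e0.
  by exists 0 => p x0 x -> _; rewrite subrr normr0 ltW.
(* The bound obtained for `|D x0| is 2M/L + L e'; each term is made at most
   e/2 by this choice of L and then of e'. *)
have [L] := archK (4 * M / e).
rewrite ger0_norm ?mulr_ge0// ?invr_ge0 ?(ltW e0)// ltr_pdivrMr// => ML.
have L0 : 0 < L%:R :> K.
  by rewrite -(pmulr_lgt0 _ e0); apply: le_lt_trans ML; rewrite mulr_ge0.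
pose e' := e / (2 * L%:R).
have e'0 : 0 < e' by rewrite divr_gt0// mulr_gt0.
have [N' HN'] := IHn (M + M) e' (addr_ge0 M0 M0) e'0.
exists (L + N').+1 => p x0 x pn pM.
pose D := fdiff x p; rewrite -/(D x0).
have D2 j : (j <= L)%N -> `|D (x0 + x *+ j.+1) - D (x0 + x *+ j)| <= e'.
  move=> jL; rewrite mulrSr addrA; apply: HN' (pn x) _.
  move=> i iN; rewrite /D/fdiff -!(addrA x0) -mulrnDr -mulrSr.
  by apply: (le_trans (ler_normB _ _)); apply: lerD; apply: pM; lia.
have D1 j : (j <= L)%N -> `|D (x0 + x *+ j) - D x0| <= L%:R * e'.
  move=> jL; apply: (@le_trans _ _ (j%:R * e')); last first.
    by rewrite ler_wpM2r ?ler_nat// ltW.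
  elim: j jL => [|j IHj] jL; first by rewrite mulr0n addr0 subrr normr0 mul0r.
  rewrite -(subrKA (D (x0 + x *+ j))) -natr1 mulrDl mul1r addrC.
  apply: (le_trans (ler_normD _ _)).
  by apply: lerD; [exact/IHj/ltnW|exact/D2/ltnW].
have D0 j : (j <= L)%N ->
    `|p (x0 + x *+ j) - p x0 - D x0 *+ j| <= j%:R * (L%:R * e').
  elim: j => [|j IHj] jL.
    by rewrite !mulr0n addr0 subrr subr0 normr0 mul0r.
  have -> : p (x0 + x *+ j.+1) - p x0 - D x0 *+ j.+1 =
      (p (x0 + x *+ j) - p x0 - D x0 *+ j) + (D (x0 + x *+ j) - D x0).
    have -> : D (x0 + x *+ j) = p (x0 + x *+ j.+1) - p (x0 + x *+ j).
      by rewrite mulrSr addrA.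
    rewrite (mulrSr (D x0)) opprD [RHS]addrACA; congr (_ + _).
    by rewrite addrC subrKA.
  rewrite -natr1 mulrDl mul1r.
  apply: (le_trans (ler_normD _ _)).
  by apply: lerD; [exact/IHj/ltnW|exact/D1/ltnW].
have : `|D x0 *+ L| <= M + M + L%:R * (L%:R * e').
  rewrite -[D x0 *+ L](subKr (p (x0 + x *+ L) - p x0)).
  apply: (le_trans (ler_normB _ _)); apply: lerD; last exact: D0.
  apply: (le_trans (ler_normB _ _)); apply: lerD; first by apply: pM; lia.
  by rewrite -[x0]addr0 -(mulr0n x); exact: pM.
rewrite normrMn -(mulr_natl `|D x0|) => DL; rewrite -(ler_pM2l L0).
apply: (le_trans DL).
have -> : L%:R * (L%:R * e') = L%:R * e / 2.
  by rewrite /e'; field; rewrite gt_eqF.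
rewrite -(@ler_pM2l _ 2)//.
have -> : 2 * (M + M + L%:R * e / 2) = 4 * M + L%:R * e by field.
by rewrite (mulr_natl (L%:R * e)) mulr2n lerD2r ltW.
Qed.

End quantitative.

(** * Neighbourhoods of zero and connectedness *)

Section topology.
Variable G : topologicalZmodType.

Lemma nbhs_translate (x : G) (A : set G) :
  nbhs x A <-> nbhs 0 [set u | A (x + u)].
Proof.
split=> xA.
  have : (fun u => x + u) @ (0 : G) --> x + 0; last by rewrite addr0; exact.
  apply: (@continuous_comp _ _ _ (fun u => (x, u)) (fun z : G * G => z.1 + z.2)).
    by apply: cvg_pair; [exact: cvg_cst|exact: cvg_id].
  exact: add_continuous.
have : (fun y => y - x) @ x --> x - x.
  apply: (@continuous_comp _ _ _ (fun y => (y, x)) (fun z : G * G => z.1 - z.2)).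
    by apply: cvg_pair; [exact: cvg_id|exact: cvg_cst].
  exact: sub_continuous.
rewrite subrr => /(_ _ xA); rewrite /nbhs/=; apply: filterS => y /=.
by rewrite addrC subrK.
Qed.

Lemma nbhs0_sums n (U : set G) : nbhs 0 U ->
  exists2 W : set G, nbhs 0 W & forall s : seq G, (size s <= n)%N ->
    [set` s] `<=` W -> U (\sum_(u <- s) u).
Proof.
elim: n U => [|n IHn] U U0.
  exists setT; first exact: filterT.
  by move=> [|//] _ _; rewrite big_nil; exact: nbhs_singleton.
have [[A B] /= [A0 B0] ABU] : nbhs ((0, 0) : G * G) [set z | U (z.1 + z.2)].
  by apply: (@add_continuous G (0, 0)); rewrite /= addr0.
have [W W0 WB] := IHn B B0.
exists (A `&` W); first exact: filterI.
move=> [_ _|u s /= sn sAW]; first by rewrite big_nil; exact: nbhs_singleton.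
have [Au _] : (A `&` W) u by apply: sAW; rewrite /= mem_head.
rewrite big_cons; apply: (ABU (u, _)); split => //=; apply: WB => // v vs.
by have [] : (A `&` W) v by apply: sAW; rewrite /= inE (vs : v \in s) orbT.
Qed.

(** The set S of such sums is stable under adding elements of U.  Hence it is
    open, and it is closed because y is in S as soon as y - U meets S. *)
Lemma connected_sums (U : set G) : connected [set: G] -> nbhs 0 U ->
  forall x, exists2 s : seq G, [set` s] `<=` U & x = \sum_(u <- s) u.
Proof.
move=> cG U0 x.
pose S := [set x | exists2 s : seq G, [set` s] `<=` U & x = \sum_(u <- s) u].
have SD s v : S s -> U v -> S (s + v).
  move=> [t tU ->] Uv; exists (v :: t); last by rewrite big_cons addrC.
  by move=> w; rewrite /= inE => /orP[/eqP->//|]; exact: tU.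
suff ST : S = [set: G] by have : S x by rewrite ST.
apply: cG.
- by exists 0, [::] => //; rewrite big_nil.
- exists S; last by rewrite setTI.
  rewrite openE => y Sy; apply/nbhs_translate.
  by apply: filterS U0 => v; exact: SD.
- exists S; last by rewrite setTI.
  move=> y clSy.
  have /clSy[z [Sz /= Uz]] : nbhs y [set z | U (y - z)].
    apply/nbhs_translate; apply: (@filterS _ _ _ (-%R @^-1` U)).
      by move=> u /=; rewrite opprD addrA subrr sub0r.
    by apply: opp_continuous; rewrite oppr0.
  by rewrite -(subrK z y) addrC; exact: SD.
Qed.

End topology.

(** A clopen set containing (a, b) contains T x {b}, hence each {x} x U. *)
Lemma connected_prod (T U : topologicalType) :
  connected [set: T] -> connected [set: U] -> connected [set: T * U].
Proof.
move=> cT cU B [[a b] Bab] [C oC BC] [D cD BD].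
rewrite setTI in BC; rewrite setTI in BD.
have oB : open B by rewrite BC.
have cB : closed B by rewrite BD.
have cl (x : T) : continuous (fun y : U => (x, y)).
  by move=> y; apply: cvg_pair; [exact: cvg_cst|exact: cvg_id].
have cr (y : U) : continuous (fun x : T => (x, y)).
  by move=> x; apply: cvg_pair; [exact: cvg_id|exact: cvg_cst].
have BT : (fun x => (x, b)) @^-1` B = [set: T].
  apply: cT; first by exists a.
  - exists ((fun x => (x, b)) @^-1` B); last by rewrite setTI.
    by apply: open_comp => // x _; exact: cr.
  - exists ((fun x => (x, b)) @^-1` B); last by rewrite setTI.
    by apply: preimage_closed => // x _; exact: cr.
apply/seteqP; split=> // -[x y] _.
have BU : (fun y => (x, y)) @^-1` B = [set: U].
  apply: cU; first by exists b; have : [set: T] x by []; rewrite -BT.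
  - exists ((fun y => (x, y)) @^-1` B); last by rewrite setTI.
    by apply: open_comp => // z _; exact: cl.
  - exists ((fun y => (x, y)) @^-1` B); last by rewrite setTI.
    by apply: preimage_closed => // z _; exact: cl.
by have : [set: U] y by []; rewrite -BU.
Qed.

(** * Continuity at one point *)

Section continuity.
Variables (K : numFieldType) (archK : Num.archimedean_axiom K).
Variables (V : pseudoMetricNormedZmodType K) (G : topologicalZmodType).

Lemma degree_lt_continuous n (p : G -> V) z :
    connected [set: G] -> degree_lt n p -> {for z, continuous p} ->
  continuous p.
Proof.
move=> cG pn pz x.
have [U U0 pU] : exists2 U : set G, nbhs 0 U &
    forall u, U u -> `|p (z + u)| <= `|p z| + 1.
  move/cvgrPdist_le : pz => /(_ 1 ltr01) /= /nbhs_translate pz1.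
  exists [set u | `|p z - p (z + u)| <= 1] => //= u; rewrite distrC => pu.
  rewrite -[p (z + u)](subrK (p z)) addrC.
  by rewrite (le_trans (ler_normD _ _))// lerD2l.
have [W W0 WU] := nbhs0_sums n U0.
have M0 : 0 <= `|p z| + 1 by rewrite addr_ge0.
have growth s : [set` s] `<=` W ->
    `|p (z + \sum_(u <- s) u)| <= (`|p z| + 1) * 3 ^+ size s.
  move=> sW; apply: (norm_growth M0 pn _ sW) => t tn tW.
  by apply: pU; apply: WU => //; exact: ltnW.
have [s sW xzs] := connected_sums cG W0 (x - z).
(* Absorbing one more summand w bounds p on all of x + W. *)
have pxW w : W w -> `|p (x + w)| <= (`|p z| + 1) * 3 ^+ (size s).+1.
  move=> Ww; have -> : x + w = z + \sum_(u <- w :: s) u.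
    by rewrite big_cons -xzs addrCA addrC [z + _]addrC subrK.
  apply: (growth (w :: s)) => v.
  by rewrite /= inE => /orP[/eqP->//|]; exact: sW.
apply/cvgrPdist_le => e e0.
have [N smallN] := @increment_small G K V archK n _ _
  (mulr_ge0 M0 (exprn_ge0 (size s).+1 (ler0n K 3))) e0.
(* Multiples of w up to N are sums of at most N elements of W'. *)
have [W' W'0 W'W] := nbhs0_sums N W0.
apply/nbhs_translate; apply: filterS W'0 => w W'w /=.
rewrite distrC; apply: smallN pn _ => j jN; apply: pxW.
have -> : w *+ j = \sum_(u <- nseq j w) u.
  by rewrite big_nseq; elim: j {jN} => //= j <-; rewrite mulrS.
by apply: W'W => [|v]; rewrite /= ?size_nseq// mem_nseq => /andP[_ /eqP->].
Qed.

End continuity.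

(** * Generalized polynomials and the sigma-ideal *)

Section GP.
Variable R : realType.

Lemma GP_degree_lt (G : topologicalZmodType) (f : G -> Cplx R) :
  GP R G f <-> continuous f /\ exists n, degree_lt n f.
Proof.
(* n + 1 differences in the definition: killed by n of them implies killed by
   one more. *)
split=> -[cf [n fn]]; split=> //.
  by exists n.+1; apply/degree_lt_foldr.
by exists n; apply/degree_lt_foldr; exact: degree_ltS.
Qed.

Lemma GPB (G : topologicalZmodType) (f g : G -> Cplx R) :
  GP R G f -> GP R G g -> GP R G (fun x => f x - g x).
Proof.
move=> /GP_degree_lt[cf [m fm]] /GP_degree_lt[cg [n gn]]; apply/GP_degree_lt.
split; first by move=> x; apply: cvgB; [exact: cf|exact: cg].
exists (maxn m n); apply: degree_ltB.
  by apply: degree_lt_leq fm; exact: leq_maxl.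
by apply: degree_lt_leq gn; exact: leq_maxr.
Qed.

Lemma sigma_N_GP_bigcup (G : topologicalZmodType) (A : nat -> set G) :
  (forall k, sigma_N_GP R G (A k)) -> sigma_N_GP R G (\bigcup_k A k).
Proof.
move=> sA I sI; have [[_ _ IU] _] := sI.
by apply: IU => k; exact: sA sI.
Qed.

Lemma GP_foldr_fdiff (G : topologicalZmodType) (H : zmodType)
    (f : G -> H -> Cplx R) (hs : seq H) y :
    (forall y, GP R G (f^~ y)) ->
  GP R G (fun x => foldr (@fdiff H (Cplx R)) (f x) hs y).
Proof.
by move=> fG; elim: hs y => [|h hs IHhs] y //=; exact: GPB.
Qed.

(** The only place where the hypothesis on the sigma-ideal enters: it provides
    one n such that a generalized polynomial in x is determined by its values on
    the set A n of points whose sections have degree less than n. *)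
Lemma degree_lt_uniform (G : topologicalZmodType) (H : zmodType)
    (f : G -> H -> Cplx R) :
    ~ sigma_N_GP R G [set: G] ->
    (forall y, GP R G (f^~ y)) -> (forall x, exists n, degree_lt n (f x)) ->
  exists n, forall x, degree_lt n (f x).
Proof.
move=> nG fG fH; pose A n := [set x | degree_lt n (f x)].
have [n nAn] : exists n, ~ sigma_N_GP R G (A n).
  apply: contrapT => /forallNP sA; apply: nG.
  have -> : [set: G] = \bigcup_n A n.
    by apply/seteqP; split=> // x _; have [n xn] := fH x; exists n.
  by apply: sigma_N_GP_bigcup => n; apply: contrapT; exact: sA.
exists n => x; apply/degree_lt_foldr => hs; apply/funext => y.
pose p x := foldr (@fdiff H (Cplx R)) (f x) hs y.
suff p0 : p = (fun=> 0) by rewrite -/(p x) p0.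
apply: contrapT => pN0; apply: nAn; apply: sub_gen_smallest.
exists p; split => //; first exact: GP_foldr_fdiff.
by move=> z /degree_lt_foldr/(_ hs) pz; rewrite /zero_set/= /p pz.
Qed.

Lemma separately_GP_degree_lt (G H : topologicalZmodType)
    (f : G * H -> Cplx R) :
    ~ sigma_N_GP R G [set: G] -> ~ sigma_N_GP R H [set: H] ->
  separately_GP f -> exists n, degree_lt n f.
Proof.
move=> nG nH [fH fG].
have [n fn] := @degree_lt_uniform G H (fun x y => f (x, y)) nG fG
  (fun x => ((GP_degree_lt _).1 (fH x)).2).
have [m fm] := @degree_lt_uniform H G (fun y x => f (x, y)) nH fH
  (fun y => ((GP_degree_lt _).1 (fG y)).2).
by exists (m + n)%N; exact: separately_degree_lt.
Qed.

Lemma complex_archimedean : Num.archimedean_axiom (complex R).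
Proof.
move=> z; have /archi_boundP := normr_ge0 (complex.Re `|z|).
set n := Num.bound _ => zn; exists n.
rewrite -[ltRHS](rmorph_nat (real_complex R)).
have -> : `|z| = (complex.Re `|z|)%:C%C by rewrite normc_def.
by rewrite ltcR; apply: le_lt_trans zn; exact: ler_norm.
Qed.

End GP.

Theorem theorem5 (R : realType) (G H : topologicalZmodType)
    (hG : ~ sigma_N_GP R G [set: G]) (hH : ~ sigma_N_GP R H [set: H]) :
  [/\ forall f : G * H -> Cplx R, separately_GP f ->
        GP R (discrete_topology (prod_topZmod G H)) f,
      forall f : G * H -> Cplx R, continuous f -> separately_GP f ->
        GP R (prod_topZmod G H) f &
      connected [set: G] -> connected [set: H] ->
      forall f : G * H -> Cplx R, separately_GP f ->
        (exists z : G * H, {for z, continuous f}) ->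
        GP R (prod_topZmod G H) f].
Proof.
split=> [f sf|f cf sf|cG cH f sf [z fz]].
- have [n fn] := separately_GP_degree_lt hG hH sf.
  apply/GP_degree_lt; split; last by exists n.
  move=> x U /nbhs_singleton fxU.
  by apply: (@filterS _ (nbhs x) _ [set x]); [move=> _ ->|exact: discrete_set1].
- have [n fn] := separately_GP_degree_lt hG hH sf.
  by apply/GP_degree_lt; split; last by exists n.
- have [n fn] := separately_GP_degree_lt hG hH sf.
  apply/GP_degree_lt; split; last by exists n.
  apply: (@degree_lt_continuous _ (@complex_archimedean R) (Cplx R)
    (prod_topZmod G H) n f z _ fn fz).
  exact: connected_prod.
Qed.
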